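(* Let $n\ge3$. The Schur index with respect to $\mathbb{Q}$ of any irreducible complex representation of $\mathrm{Hol}(C_{2^n})$ is equal to $1$.
   Context: $C_m$ is the cyclic group of order $m$; $\mathrm{Hol}(C_m)=C_m\rtimes\mathrm{Aut}(C_m)$ for the natural action. For an irreducible complex representation $\widetilde\rho$ of a finite group $G$, there is a unique irreducible $\mathbb{Q}$-representation $\rho$ of $G$ such that $\widetilde\rho$ is a constituent of $\rho\otimes_{\mathbb{Q}}\mathbb{C}$; the Schur index of $\widetilde\rho$ with respect to $\mathbb{Q}$ is the multiplicity of $\widetilde\rho$ in $\rho\otimes_{\mathbb{Q}}\mathbb{C}$. *)

(* Defs.v *)
From HB Require Import structures.
From mathcomp Require Import all_boot all_order all_algebra.
From mathcomp Require Import all_fingroup all_solvable all_field all_character.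
From mathcomp Require Import boolp classical_sets reals complex.

Set Implicit Arguments.
Unset Strict Implicit.
Unset Printing Implicit Defensive.

Import GroupScope GRing.Theory Num.Theory.
Local Open Scope ring_scope.

(* [Aut A] is the natural action of the group Aut A of automorphisms of A. *)
Definition Hol (gT : finGroupType) (A : {group gT}) : finGroupType :=
  sdprod_groupType [Aut A]%gact.

(* DecSocleType rV indexes the isotypic components of the socle of rV, which   *)
(* is all of rV in characteristic 0; at most one of them is of the type of rG. *)
Definition mx_multiplicity (F : decFieldType) (gT : finGroupType)
    (G : {group gT}) (d e : nat) (rG : mx_representation F G d)
    (rV : mx_representation F G e) : nat :=
  (\sum_(W : DecSocleType rV | `[< mx_rsim rG (socle_repr W) >])
      socle_mult W)%N.

Definition extend_scalars (K : numFieldType) (gT : finGroupType)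
    (G : {group gT}) (e : nat) (rho : mx_representation rat G e) :
    mx_representation K G e :=
  map_repr (ratr : {rmorphism rat -> K}) rho.

(* The irreducible rational representation rho is unique up to isomorphism,    *)
(* so at most one m is eligible; the default value 0 is not a multiplicity of  *)
(* a constituent.                                                              *)
Definition schur_index (R : realType) (gT : finGroupType) (G : {group gT})
    (d : nat) (rG : mx_representation R[i] G d) : nat :=
  xget 0%N [set m : nat | exists (e : nat) (rho : mx_representation rat G e),
    [/\ mx_irreducible rho,
        (0 < mx_multiplicity rG (extend_scalars R[i] rho))%N
      & m = mx_multiplicity rG (extend_scalars R[i] rho)]]%classic.

(* Main.v *)
Require Import Defs.
From mathcomp Require Import all_boot all_order all_algebra.
From mathcomp Require Import all_fingroup all_solvable all_field all_character.
From mathcomp Require Import boolp reals complex.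
From mathcomp Require Import ring.

(** The idea is to find, for every irreducible complex module V of
    G = Hol(C_{2^n}), a subgroup H whose fixed space in V is a line, i.e. such
    that z = sum_{h in H} h acts on V with rank 1.  This forces Schur index 1:
    if W is an irreducible rational module with V inside W_C, then W z <> 0, so
    W_C is generated by a vector in the image of z, and a homomorphism
    W_C -> V is determined by the image of that vector, which lies in the line
    V z; hence Hom(W_C, V) has dimension at most 1.

    Write G as the set of the x^i s_t with t odd and s_t x = x^t s_t.  V is
    spanned by weight vectors v s_t, where v x = zeta v for a primitive 2^k-th
    root of unity zeta and v s_t = mu(t) v for t = 1 mod 2^k.  For k > 0, let
    k + j be the conductor exponent of mu.  Then H is made of the
    x^(c (t - 1) / 2^j) s_t with t odd, t = 1 mod 2^j, where c is chosen so that the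
    elements of H with t = 1 mod 2^k fix v.  On every weight line
    outside the H-orbit of the line of v, some such element acts non-trivially. *)

Set Implicit Arguments.
Unset Strict Implicit.
Unset Printing Implicit Defensive.

Import GroupScope GRing.Theory Num.Theory.
Local Open Scope ring_scope.

(** * Multiplicities and elements of rank one *)

Section Intertwiners.

Variables (F : fieldType) (gT : finGroupType) (G : {group gT}).
Lemma intertwine_sum (d e : nat) (rG : mx_representation F G d)
    (rV : mx_representation F G e) (N : 'M_(d, e)) (H : {set gT}) :
    H \subset G -> (forall g, g \in G -> rG g *m N = N *m rV g) ->
  (\sum_(h in H) rG h) *m N = N *m \sum_(h in H) rV h.
Proof.
move=> sHG homN; rewrite mulmx_suml mulmx_sumr; apply: eq_bigr => h Hh.
by apply: homN; apply: (subsetP sHG).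
Qed.

Lemma mxrank_intertwine_sum (d e m : nat) (rG : mx_representation F G d)
    (rV : mx_representation F G e) (N : 'M_(d, e)) (M : 'M_(m, e))
    (H : {set gT}) :
    H \subset G -> (forall g, g \in G -> rG g *m N = N *m rV g) ->
    (M <= N)%MS ->
  (\rank (M *m \sum_(h in H) rV h)%R <= \rank (\sum_(h in H) rG h)%R)%N.
Proof.
move=> sHG homN sMN; apply: leq_trans (mxrankS (submxMr _ sMN)) _.
by rewrite -(intertwine_sum sHG homN) mxrankM_maxl.
Qed.

(** The image under [q] of the cyclic module generated by [w] is the cyclic module generated by
    [w *m q], so an endomorphism is determined by its value on a generator. *)
Lemma centgmx_kill_cyclic (e : nat) (rV : mx_representation F G e)
    (w : 'rV_e) (q : 'M_e) :
    (1%:M <= cyclic_mx rV w)%MS ->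
    (forall g, g \in G -> rV g *m q = q *m rV g) ->
  w *m q = 0 -> q = 0.
Proof.
move=> genw homq wq0; apply/eqP; rewrite -(mul1mx q) -submx0.
have domq: (w <= dom_hom_mx rV q)%MS.
  by apply/hom_mxP=> x Gx; rewrite -!mulmxA homq.
apply: submx_trans (submxMr q genw) _.
rewrite (hom_cyclic_mx domq) wq0 submx0.
by rewrite cyclic_mx_eq0.
Qed.

(** Maschke's theorem: the projection onto [U] along an invariant complement [Y] commutes with the
    action. [Y] is kept because its submodules are killed by [q]. *)
Lemma split_proj_mx (e : nat) (rV : mx_representation F G e) (U : 'M_e) :
    [pchar F]^'.-group G -> mxmodule rV U ->
  exists q : 'M_e, [/\ U *m q = U, (q <= U)%MS,
    forall g, g \in G -> rV g *m q = q *m rV g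
    & exists2 Y : 'M_e, mxmodule rV Y & (U + Y :=: 1%:M)%MS /\ Y *m q = 0].
Proof.
move=> F'G modU.
have [Y modY defUY dxUY] := mx_Maschke_pchar rV F'G modU (submx1 U).
have{} dxUY: (U :&: Y = 0)%MS by apply/mxdirect_addsP.
exists (proj_mx U Y); split.
- exact: proj_mx_id.
- by rewrite -[X in (X <= _)%MS]mul1mx proj_mx_sub.
- move=> g Gg.
  have hom1: (1%:M <= dom_hom_mx rV (proj_mx U Y))%MS.
    by rewrite -defUY; apply: proj_mx_hom.
  by have := hom_mxP hom1 g Gg; rewrite !mul1mx.
by exists Y => //; split=> //; apply: proj_mx_0.
Qed.

End Intertwiners.

Section RankOneMultiplicity.

Variables (F : decFieldType) (gT : finGroupType) (G : {group gT}).
Hypothesis F'G : [pchar F]^'.-group G.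

(* An endomorphism is determined by its value on the generator [w0 *m z], and
   endomorphisms into [M] send it to the line [M *m z]; so two projections onto
   independent copies of [M] cannot coexist. *)
Lemma component_mx_rank1_cyclic (e : nat) (rV : mx_representation F G e)
    (H : {set gT}) (M : 'M_e) (w0 : 'rV_e) (z := \sum_(h in H) rV h) :
    H \subset G -> mxsimple rV M -> (\rank (M *m z) <= 1)%N ->
    (1%:M <= cyclic_mx rV (w0 *m z))%MS ->
  (component_mx rV M <= M)%MS.
Proof.
move=> sHG simM rkMz genw; set X := component_mx rV M.
have [modM nzM _] := simM.
have [q1 [Mq1 q1M homq1 [Y modY [defMY Yq1]]]] := split_proj_mx F'G modM.
have sMX: (M <= X)%MS by apply: component_mx_id.
(* By the modular law [X] is the sum of [M] and [X :&: Y]. A nonzero intersection would contain a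
   second copy [U] of [M]. *)
suffices XY0: (X :&: Y)%MS = 0.
  have: (X <= (M + Y) :&: X)%MS by rewrite sub_capmx defMY submx1 submx_refl.
  by rewrite -(matrix_modl Y sMX) capmxC XY0 addsmx0.
apply/eqP; apply: contraT => nzXY.
have modXY: mxmodule rV (X :&: Y)%MS by rewrite capmx_module ?component_mx_module.
have [U simU] := dec_mxsimple_exists modXY nzXY.
rewrite sub_capmx => /andP[sUX sUY]; have [modU nzU _] := simU.
have [f injf homf defM] : mx_iso rV U M.
  by apply: mx_iso_sym; apply: component_mx_iso.
have [p [Up pU homp _]] := split_proj_mx F'G modU.
(* A second endomorphism with values in [M]: project onto [U], then identify [U] with [M]. *)
pose q2 := p *m f.
have homq2 g : g \in G -> rV g *m q2 = q2 *m rV g.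
  move=> Gg; rewrite mulmxA homp // -!mulmxA.
  have homp2 : (p <= dom_hom_mx rV f)%MS by apply: submx_trans pU homf.
  by rewrite !mulmxA (hom_mxP homp2).
have q2M: (q2 <= M)%MS by rewrite -defM submxMr.
have to_Mz q : (q <= M)%MS -> (forall g, g \in G -> rV g *m q = q *m rV g) ->
    (w0 *m z *m q <= M *m z)%MS.
  move=> qM homq; rewrite -mulmxA (intertwine_sum sHG homq) mulmxA submxMr //.
  exact: submx_trans (submxMl _ _) qM.
have nzq1: w0 *m z *m q1 != 0.
  apply: contra nzM => /eqP/(centgmx_kill_cyclic genw homq1) q10.
  by rewrite -Mq1 q10 mulmx0.
(* Both values lie in [M *m z], of rank at most 1, and the value of [q1] is nonzero. *)
have [c def_q2] : exists c, w0 *m z *m q2 = c *: (w0 *m z *m q1).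
  apply/sub_rVP; apply: submx_trans (to_Mz _ q2M homq2) _.
  rewrite -(geq_leqif (mxrank_leqif_sup (to_Mz _ q1M homq1))).
  by apply: leq_trans rkMz _; rewrite lt0n mxrank_eq0.
have /eqP: q2 - c *: q1 = 0.
  apply: (centgmx_kill_cyclic genw) => [g Gg|].
    by rewrite mulmxBr mulmxBl homq2 // -scalemxAr -scalemxAl homq1.
  by rewrite mulmxBr -scalemxAr def_q2 subrr.
(* Contradiction: [q2] maps [U] onto [M], whereas [q1] kills [U], which lies in [Y]. *)
rewrite subr_eq0 => /eqP eq_q; case/negP: nzM.
rewrite -submx0 -defM -Up -mulmxA -/q2 eq_q -scalemxAr.
have [D ->] := submxP sUY.
by rewrite -mulmxA Yq1 mulmx0 scaler0 sub0mx.
Qed.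

Lemma mx_rsim_submod_hom (d e : nat) (rG : mx_representation F G d)
    (rV : mx_representation F G e) (M : 'M_e) (modM : mxmodule rV M) :
    mx_rsim rG (submod_repr modM) ->
  exists N : 'M_(d, e), [/\ row_free N, (N :=: M)%MS
    & forall g, g \in G -> rG g *m N = N *m rV g].
Proof.
case=> B eqd freeB homB.
pose v := val_submod (1%:M : 'M_(\rank M)).
have homv g : g \in G -> submod_repr modM g *m v = v *m rV g.
  by move=> Gg; rewrite -[RHS](val_submodJ modM) // mul1mx [RHS]val_submodE.
have def_v : (v :=: M)%MS by apply: val_submod1.
have rkB : row_full B by rewrite /row_full (eqP freeB) eqd.
exists (B *m v); split=> [||g Gg].
- by rewrite /row_free mxrankMfree // /row_free def_v.
- exact: eqmx_trans (eqmxMfull v rkB) def_v.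
by rewrite mulmxA homB // -[LHS]mulmxA homv // mulmxA.
Qed.

(** By Schur's argument a nonzero [N] is injective; its image is a simple submodule of the type of
    [rG], and the isotypic component of that image contributes to the sum. *)
Lemma hom_mx_multiplicity_gt0 (d e : nat) (rG : mx_representation F G d)
    (rV : mx_representation F G e) (N : 'M_(d, e)) :
    mx_irreducible rG -> N != 0 ->
    (forall g, g \in G -> rG g *m N = N *m rV g) ->
  (0 < mx_multiplicity rG rV)%N.
Proof.
move=> irrG nzN homN.
have freeN : row_free N.
  rewrite -kermx_eq0; apply: contraR nzN => nzK.
  have [_ minG] := (mx_irrP _).1 irrG.
  have modK : mxmodule rG (kermx N).
    apply/mxmoduleP=> g Gg; apply/sub_kermxP.
    by rewrite -mulmxA homN // mulmxA mulmx_ker mul0mx.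
  have := minG _ modK nzK; rewrite -sub1mx => /sub_kermxP.
  by rewrite mul1mx => ->.
pose M := <<N>>%MS.
have modM : mxmodule rV M.
  rewrite (eqmx_module _ (genmxE N)); apply/mxmoduleP=> g Gg.
  by rewrite -homN // submxMl.
have simG : mx_rsim rG (submod_repr modM).
  have rkM : \rank M = d by rewrite genmxE (eqP freeN).
  have sNM : (N <= M)%MS by rewrite genmxE.
  exists (in_submod M N) => // [|g Gg].
    by rewrite /row_free mxrank_in_submod // (eqP freeN).
  by rewrite -in_submodJ // -homN // in_submodE [in RHS]in_submodE mulmxA.
have simM : mxsimple rV M by apply/(submod_mx_irr modM); apply: mx_rsim_irr simG irrG.
pose W := PackSocle (component_socle (DecSocleType rV) simM).
have simW : mx_rsim rG (socle_repr W).
  apply: mx_rsim_trans simG _; apply: mx_rsim_sym; apply/mx_rsim_iso.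
  apply: (component_mx_iso (socle_simple _)) => //.
  by rewrite [component_mx _ _]PackSocleK component_mx_id.
rewrite /mx_multiplicity (bigD1 W) /=; last exact/asboolP.
rewrite addn_gt0 /socle_mult divn_gt0; last first.
  by rewrite lt0n mxrank_eq0; case: (socle_simple W).
by rewrite mxrankS // component_mx_id //; apply: socle_simple.
Qed.

Lemma mx_multiplicity_gt0_hom (d e : nat) (rG : mx_representation F G d)
    (rV : mx_representation F G e) :
    (0 < mx_multiplicity rG rV)%N ->
  exists2 N : 'M_(d, e), row_free N & forall g, g \in G -> rG g *m N = N *m rV g.
Proof.
rewrite /mx_multiplicity.
case: (pickP (fun W : DecSocleType rV => `[< mx_rsim rG (socle_repr W) >]))
    => [W simW _|no]; last by rewrite big_pred0.
by have [N [freeN _ homN]] := mx_rsim_submod_hom (asboolP _ simW); exists N.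
Qed.

(** Only one isotypic component [W] has the type of [rG], and the rank one argument reduces [W] to
    its simple base. *)
Lemma mx_multiplicity_rank1_cyclic (d e : nat) (rG : mx_representation F G d)
    (rV : mx_representation F G e) (H : {set gT}) (w0 : 'rV_e) :
    H \subset G -> (\rank (\sum_(h in H) rG h)%R <= 1)%N ->
    (1%:M <= cyclic_mx rV (w0 *m \sum_(h in H) rV h)%R)%MS ->
  (0 < mx_multiplicity rG rV)%N -> mx_multiplicity rG rV = 1%N.
Proof.
move=> sHG rk1 genw; rewrite /mx_multiplicity.
case: (pickP (fun W : DecSocleType rV => `[< mx_rsim rG (socle_repr W) >]))
    => [W simW _|no]; last by rewrite big_pred0.
rewrite (bigD1 W) //= big1 ?addn0 => [|W' /andP[simW' neqW']]; last first.
  case/negP: neqW'; apply/socle_rsimP.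
  by apply: mx_rsim_trans (asboolP _ simW); apply: mx_rsim_sym; apply/asboolP.
have [N [_ defN homN]] := mx_rsim_submod_hom (asboolP _ simW).
have simM := socle_simple W.
have M_gt0 : (0 < \rank (socle_base W))%N by rewrite lt0n mxrank_eq0; case: simM.
rewrite /socle_mult; suff ->: \rank W = \rank (socle_base W) by rewrite divnn M_gt0.
apply/eqP; rewrite eqn_leq !mxrankS ?component_mx_id //.
apply: component_mx_rank1_cyclic genw => //.
by apply: leq_trans rk1; apply: mxrank_intertwine_sum homN _; rewrite ?defN.
Qed.

End RankOneMultiplicity.

(** * Rational irreducible modules containing a given module *)

Section Descent.

Variables (aF rF : fieldType) (f : {rmorphism aF -> rF}).
Variables (gT : finGroupType) (G : {group gT}) (d : nat).
Variable rG : mx_representation rF G d.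

(** For irreducible [rG] a nonzero homomorphism is an embedding. Asking only for a nonzero one lets
    the property pass to a submodule or a quotient of [rho]. *)
Definition embeds_over (e : nat) (rho : mx_representation aF G e) : Prop :=
  exists2 N : 'M[rF]_(d, e), N != 0 &
    forall g, g \in G -> rG g *m N = N *m map_repr f rho g.

(** The homomorphism is given by matrix coefficients: a vector goes to the function sending [g] to
    coordinate [i0] of its image under [g^-1]. At the identity, row [i0] has value 1. *)
Lemma embeds_over_regular : (0 < d)%N -> embeds_over (regular_repr aF G).
Proof.
move=> d_gt0; pose i0 := Ordinal d_gt0.
pose N : 'M[rF]_(d, #|G|) := \matrix_(i, j) rG (enum_val j)^-1%g i i0.
exists N => [|g Gg].
  apply/negP=> /eqP/matrixP/(_ i0 (enum_rank_in (group1 G) 1%g)) /eqP.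
  rewrite !mxE enum_rankK_in ?group1 // invg1 repr_mx1 !mxE eqxx.
  by rewrite oner_eq0.
apply/matrixP=> i j; rewrite !mxE.
have Gj := enum_valP j.
pose j' := enum_rank_in (group1 G) (enum_val j * g^-1)%g.
have Gj' : (enum_val j * g^-1)%g \in G by rewrite groupM ?groupV.
rewrite (bigD1 j') //= [X in _ = _ + X]big1 ?addr0 => [|k nek].
  rewrite map_regular_repr !mxE enum_rankK_in // invMg invgK.
  rewrite (_ : gring_index G _ = j) ?eqxx ?mulr1; last first.
    by apply: enum_val_inj; rewrite gring_indexK mulgKV.
  rewrite repr_mxM ?groupV // mxE; apply: eq_bigr => k _.
  by rewrite !mxE.
rewrite map_regular_repr !mxE eqxx /=; case: eqP => [|_]; last by rewrite mulr0.
move=> def_j; case/eqP: nek; apply: enum_val_inj.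
by rewrite enum_rankK_in // def_j gring_indexK ?mulgK // groupM ?enum_valP.
Qed.

(** Either the composite of [N] with the quotient map is nonzero, or [N] takes its values in the
    scalar extension of [U]. *)
Lemma embeds_over_sub_fact (e : nat) (rho : mx_representation aF G e)
    (U : 'M_e) (modU : mxmodule rho U) :
  embeds_over rho ->
  embeds_over (submod_repr modU) \/ embeds_over (factmod_repr modU).
Proof.
case=> N nzN homN.
pose Q := in_factmod U 1%:M.
have homQ g : g \in G -> rho g *m Q = Q *m factmod_repr modU g.
  by move=> Gg; rewrite -[RHS](in_factmodJ modU) // mul1mx [RHS]in_factmodE.
pose v := val_submod (1%:M : 'M_(\rank U)).
have homv g : g \in G -> submod_repr modU g *m v = v *m rho g.
  by move=> Gg; rewrite -[RHS](val_submodJ modU) // mul1mx [RHS]val_submodE.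
have def_v : (v :=: U)%MS by apply: val_submod1.
have freev : row_free v by rewrite /row_free def_v.
have kerQ : (kermx Q <= U)%MS.
  by rewrite -in_factmod_eq0 in_factmodE mulmx_ker.
have [NQ0|nzNQ] := eqVneq (N *m map_mx f Q) 0; [left | right]; last first.
  exists (N *m map_mx f Q) => // g Gg.
  by rewrite mulmxA homN // -[LHS]mulmxA -[RHS]mulmxA -!map_mxM homQ.
have : (N <= map_mx f v)%MS.
  apply: submx_trans (_ : (N <= map_mx f (kermx Q))%MS) _.
    by rewrite map_kermx; apply/sub_kermxP.
  by rewrite map_submx def_v.
case/submxP=> N' defN; exists N' => [|g Gg].
  by apply: contra nzN => /eqP N'0; rewrite defN N'0 mul0mx.
have freefv : row_free (map_mx f v) by rewrite /row_free mxrank_map.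
apply: (row_free_inj freefv).
rewrite -[LHS]mulmxA -defN homN // -[RHS]mulmxA -map_mxM homv //.
by rewrite map_mxM mulmxA -defN.
Qed.

(** A [rho] of minimal degree is irreducible: a proper nonzero submodule would give a submodule or a
    quotient of smaller degree with the same property. *)
Lemma embeds_over_irreducible :
    (0 < d)%N ->
  exists (e : nat) (rho : mx_representation aF G e),
    mx_irreducible rho /\ embeds_over rho.
Proof.
move=> d_gt0.
have ex_e : exists e, `[< exists rho : mx_representation aF G e, embeds_over rho >].
  by exists #|G|; apply/asboolP; exists (regular_repr aF G); apply: embeds_over_regular.
case: (ex_minnP ex_e) => e /asboolP[rho emb_rho] min_e.
exists e, rho; split=> //; have [N nzN _] := emb_rho.
apply/mx_irrP; split=> [|U modU nzU].
  rewrite lt0n; apply: contra nzN => /eqP e0.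
  by move: N; rewrite e0 => N; rewrite thinmx0.
have U_gt0 : (0 < \rank U)%N by rewrite lt0n mxrank_eq0.
rewrite /row_full eqn_leq rank_leq_row /=.
case: (embeds_over_sub_fact modU emb_rho) => emb.
  by apply: min_e; apply/asboolP; exists (submod_repr modU).
have : (e <= \rank (cokermx U))%N.
  by apply: min_e; apply/asboolP; exists (factmod_repr modU).
rewrite mxrank_coker leq_subRL ?rank_leq_row // => h.
by have := leq_trans (leq_add U_gt0 (leqnn e)) h; rewrite add1n ltnn.
Qed.

End Descent.

(** * A rank one criterion for Schur index one *)

Lemma cyclic_mx_map (aF rF : fieldType) (f : {rmorphism aF -> rF})
    (gT : finGroupType) (G : {group gT}) (e : nat)
    (rho : mx_representation aF G e) (w : 'rV_e) :
    (1%:M <= cyclic_mx rho w)%MS ->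
  (1%:M <= cyclic_mx (map_repr f rho) (map_mx f w))%MS.
Proof.
move=> genw; apply/row_subP=> i; apply/cyclic_mxP.
have /cyclic_mxP[A EA defA] := row_subP genw i.
exists (map_mx f A); first by rewrite -map_enveloping_algebra_mx memmx_map.
by rewrite -map_mxM -defA map_row map_mx1.
Qed.

Lemma pchar'_num_group (F : numFieldType) (gT : finGroupType) (G : {group gT}) :
  [pchar F]^'.-group G.
Proof. by rewrite /pgroup pcharf'_nat pnatr_eq0 -lt0n cardG_gt0. Qed.

(** The group sum [z] has rational entries and is nonzero on any eligible [rho]. A nonzero row of
    [z] generates the irreducible [rho] over the rationals, hence also its scalar extension, as the
    multiplicity criterion requires. *)
Lemma schur_index_rank1 (R : realType) (gT : finGroupType) (G : {group gT})
    (d : nat) (rG : mx_representation R[i] G d) (H : {set gT}) :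
    mx_irreducible rG -> H \subset G -> \rank (\sum_(h in H) rG h)%R = 1%N ->
  schur_index rG = 1%N.
Proof.
move=> irrG sHG rk1; have F'G := pchar'_num_group R[i] G.
pose f : {rmorphism rat -> R[i]} := ratr.
have mult1 (e : nat) (rho : mx_representation rat G e) : mx_irreducible rho ->
    (0 < mx_multiplicity rG (extend_scalars R[i] rho))%N ->
  mx_multiplicity rG (extend_scalars R[i] rho) = 1%N.
  move=> irrho mult_gt0; have [N freeN homN] := mx_multiplicity_gt0_hom mult_gt0.
  pose z : 'M_e := \sum_(h in H) rho h.
  have def_fz : \sum_(h in H) extend_scalars R[i] rho h = map_mx f z.
    by rewrite /z raddf_sum.
  have nz_z : z != 0.
    apply/eqP=> z0; suff: \rank (\sum_(h in H) rG h)%R = 0%N by rewrite rk1.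
    rewrite -(mxrankMfree _ freeN) (intertwine_sum sHG homN) def_fz z0.
    by rewrite map_mx0 mulmx0 mxrank0.
  have [i nz_zi] : exists i, row i z != 0.
    apply/existsP; apply: contraNT nz_z => /existsPn z0.
    by apply/eqP/row_matrixP=> i; rewrite row0; apply/eqP; rewrite -[_ == _]negbK z0.
  have genw : (1%:M <= cyclic_mx rho (row i z))%MS.
    have [_ _ ->] := irrho; rewrite ?cyclic_mx_module ?submx1 //.
    by rewrite cyclic_mx_eq0.
  apply: (mx_multiplicity_rank1_cyclic F'G (w0 := delta_mx 0 i)) (mult_gt0).
  - exact: sHG.
  - by rewrite rk1.
  rewrite def_fz; have := cyclic_mx_map f genw.
  by rewrite rowE map_mxM map_delta_mx.
have d_gt0 : (0 < d)%N by case/mx_irrP: irrG.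
have [e [rho [irrho [N nzN homN]]]] := embeds_over_irreducible f rG d_gt0.
have mult_gt0 : (0 < mx_multiplicity rG (extend_scalars R[i] rho))%N.
  exact: hom_mx_multiplicity_gt0 irrG nzN homN.
(* Every eligible value is 1 and one exists, so [xget] does not return its default 0. *)
rewrite /schur_index; set S := (X in classical_sets.xget _ X).
suff : S (classical_sets.xget 0%N S) by move=> [e' [rho' [irr' gt0' ->]]]; apply: mult1.
by apply: classical_sets.xgetPex; exists 1%N, e, rho; split=> //; rewrite mult1.
Qed.

(** * Characters of congruence subgroups modulo powers of two *)

Lemma eqn_mod_dvd_trans (a b c d : nat) :
  (d %| c)%N -> (a = b %[mod c])%N -> (a = b %[mod d])%N.
Proof. by move=> dvd_dc eq_ab; rewrite -(modn_dvdm a dvd_dc) eq_ab modn_dvdm. Qed.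

Lemma odd_eq1_mod_2exp (m t : nat) : (0 < m)%N -> (t = 1 %[mod 2 ^ m])%N -> odd t.
Proof.
case: m => // m _ /(eqn_mod_dvd_trans (dvdn_exp (ltn0Sn m) (dvdnn 2))).
by rewrite !modn2; case: odd.
Qed.

Lemma prim_2exp (F : fieldType) (m : nat) (w : F) :
    w ^+ (2 ^ m) = 1 -> ((0 < m)%N -> w ^+ (2 ^ m.-1) != 1) ->
  (2 ^ m).-primitive_root w.
Proof.
move=> wm nwm; have [e prim_w] := prim_order_exists (expn_gt0 2 m) wm.
case/(dvdn_pfactor _ _ (isT : prime 2)) => i le_im def_e.
have [lt_im|] := ltnP i m; last by move=> le_mi; rewrite -[m](@anti_leq i) ?le_im // -def_e.
case/eqP: (nwm (leq_ltn_trans (leq0n i) lt_im)).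
apply/eqP; rewrite -(prim_order_dvd prim_w) def_e dvdn_exp2l //.
by rewrite -ltnS (ltn_predK lt_im).
Qed.

Section TwoPowerCharacters.

Variables (F : fieldType) (k : nat) (mu : nat -> F).
Hypothesis k_gt0 : (0 < k)%N.
Hypothesis mu1 : mu 1%N = 1.
Hypothesis muM : forall t u : nat,
  (t = 1 %[mod 2 ^ k])%N -> (u = 1 %[mod 2 ^ k])%N -> mu (t * u)%N = mu t * mu u.

(** Multiplying by an inverse [t'] of [t] modulo [2 ^ L], a power of [t] by Euler's theorem, sends
    both sides to 1. *)
Lemma mu_eq_mod (L t u : nat) : (k <= L)%N ->
    (forall w : nat, (w = 1 %[mod 2 ^ L])%N -> mu w = 1) ->
    (t = 1 %[mod 2 ^ k])%N -> (t = u %[mod 2 ^ L])%N ->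
  mu t = mu u.
Proof.
move=> le_kL muL t1 eq_tu.
have dvd_kL : (2 ^ k %| 2 ^ L)%N by rewrite dvdn_exp2l.
have u1 : (u = 1 %[mod 2 ^ k])%N by rewrite -(eqn_mod_dvd_trans dvd_kL eq_tu).
have co_t : coprime t (2 ^ L) by rewrite coprimeXr // coprimen2 (odd_eq1_mod_2exp k_gt0).
pose t' := (t ^ (totient (2 ^ L)).-1)%N.
have tt' : (t * t' = 1 %[mod 2 ^ L])%N.
  by rewrite -expnS prednK ?totient_gt0 ?expn_gt0 // Euler_exp_totient.
have t'1 : (t' = 1 %[mod 2 ^ k])%N.
  by rewrite /t' -modnXm t1 modnXm exp1n.
have ut' : (u * t' = 1 %[mod 2 ^ L])%N by rewrite -modnMml -eq_tu modnMml.
have mtt' : mu t * mu t' = 1 by rewrite -muM // muL.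
have mut' : mu u * mu t' = 1 by rewrite -muM // muL.
have nz : mu t' != 0 by apply: contra_eq_neq mtt' => ->; rewrite mulr0 eq_sym oner_neq0.
by apply: (mulIf nz); rewrite mtt'.
Qed.

(** The product of [1 + 2 ^ M] and [1 + 2 ^ M * r] exceeds [1 + 2 ^ M * r.+1] by a multiple of
    [2 ^ (M + M)], which [mu] does not see. *)
Lemma mu_add (L M r : nat) : (k <= L)%N -> (k <= M)%N -> (L <= M + M)%N ->
    (forall w : nat, (w = 1 %[mod 2 ^ L])%N -> mu w = 1) ->
  mu (1 + 2 ^ M * r)%N = mu (1 + 2 ^ M)%N ^+ r.
Proof.
move=> le_kL le_kM le_LMM muL.
have K r' : (1 + 2 ^ M * r' = 1 %[mod 2 ^ k])%N.
  by rewrite -(subnK le_kM) addnC expnD mulnAC modnMDl.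
elim: r => [|r IHr]; first by rewrite muln0 addn0 mu1 expr0.
rewrite exprS -IHr -muM //; last by have := K 1%N; rewrite muln1.
apply: (mu_eq_mod le_kL muL) => //.
have -> : ((1 + 2 ^ M) * (1 + 2 ^ M * r) = 2 ^ (M + M) * r + (1 + 2 ^ M * r.+1))%N.
  by rewrite expnD; ring.
by rewrite -(subnK le_LMM) expnD mulnAC modnMDl.
Qed.

(* [k + j] is the conductor exponent of [mu]. *)
Lemma mu_conductor (n : nat) :
    (forall w : nat, (w = 1 %[mod 2 ^ n])%N -> mu w = 1) ->
  exists (j : nat) (w : F), (2 ^ minn j k).-primitive_root w
    /\ forall r : nat, mu (1 + 2 ^ maxn j k * r)%N = w ^+ r.
Proof.
move=> mun.
have ex_j : exists j, `[< forall w : nat, (w = 1 %[mod 2 ^ (k + j)])%N -> mu w = 1 >].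
  exists n; apply/asboolP => w w1; apply: mun; apply: eqn_mod_dvd_trans w1.
  by rewrite dvdn_exp2l // leq_addl.
case: (ex_minnP ex_j) => j /asboolP muL min_j {ex_j}.
set L := (k + j)%N in muL.
have le_kL : (k <= L)%N by apply: leq_addr.
pose M := maxn j k; have le_kM : (k <= M)%N by apply: leq_maxr.
have ML : (M + minn j k)%N = L by rewrite addnC addn_min_max addnC.
have le_LMM : (L <= M + M)%N.
  by rewrite -ML leq_add2l (leq_trans (geq_minr j k)).
have muE r := mu_add r le_kL le_kM le_LMM muL.
exists j, (mu (1 + 2 ^ M)%N); split=> //.
apply: prim_2exp => [|m_gt0].
  by rewrite -muE -expnD ML muL // -modnDmr modnn addn0.
have j_gt0 : (0 < j)%N by apply: leq_trans m_gt0 (geq_minl _ _).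
rewrite -muE -expnD.
have -> : (M + (minn j k).-1)%N = L.-1 by rewrite -ML -(prednK m_gt0) addnS.
have L1 : L.-1 = (k + j.-1)%N by rewrite /L -(prednK j_gt0) addnS.
(* Otherwise [mu] is 1 at [1 + 2 ^ L.-1]. A number that is 1 modulo [2 ^ L.-1] is congruent to 1 or
   to this one modulo [2 ^ L], so [j.-1] would contradict the minimality of [j]. *)
apply/negP => /eqP mu_L1; have : (j <= j.-1)%N; last by rewrite leqNgt prednK // leqnn.
apply: min_j; apply/asboolP => w; rewrite -L1 => w1.
have w_gt0 : (0 < w)%N.
  case: w w1 => //; rewrite mod0n modn_small //.
  by rewrite -[1%N](expn0 2) ltn_exp2l // L1 addn_gt0 k_gt0.
have w1k : (w = 1 %[mod 2 ^ k])%N.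
  by apply: eqn_mod_dvd_trans w1; rewrite dvdn_exp2l // L1 leq_addr.
have /dvdnP[r def_w] : (2 ^ L.-1 %| w.-1)%N.
  by rewrite -[w.-1]subn1 -(eqn_mod_dvd _ w_gt0); apply/eqP.
have {}def_w : w = (r * 2 ^ L.-1 + 1)%N by rewrite -def_w addn1 prednK.
have exp_L : (2 ^ L = 2 * 2 ^ L.-1)%N.
  by rewrite -expnS prednK // addn_gt0 k_gt0.
rewrite -(odd_double_half r) in def_w.
rewrite -muln2 mulnDl -mulnA -exp_L in def_w.
have [odd_r|even_r] := boolP (odd r); last first.
  by apply: muL; rewrite def_w (negPf even_r) mul0n add0n modnMDl.
rewrite -mu_L1; apply: (mu_eq_mod le_kL muL) => //.
by rewrite def_w odd_r mul1n [X in (X + 1)%N]addnC -addnA modnMDl addnC.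
Qed.

End TwoPowerCharacters.

(** * The rank one element *)

(** In a basis [b] of [E], the restrictions [D A] are again commuting matrices, now on a full
    space. *)
Lemma common_eigenvector_in (F : numClosedFieldType) (d : nat) (E : 'M[F]_d)
    (As : seq 'M[F]_d) :
    E != 0 -> {in As, forall A, stablemx E A} ->
    {in As &, forall A B, comm_mx A B} ->
  exists v : 'rV_d, [/\ v != 0, (v <= E)%MS & {in As, forall A, stablemx v A}].
Proof.
move=> nzE stabE commA.
have [b freeb defb] : exists2 b : 'M_(\rank E, d), row_free b & (b :=: E)%MS.
  by exists (row_base E); [apply: row_base_free | apply: eq_row_base].
have [D defD] : exists D, {in As, forall A, D A *m b = b *m A}.
  exists (fun A => b *m A *m pinvmx b).
  by move=> A AsA; rewrite mulmxKpV // (eqmx_stable _ defb) stabE.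
have [||u nzu /allP stabu] := @common_eigenvector F _ [seq D A | A <- As].
- by rewrite lt0n mxrank_eq0.
- move=> _ _ /mapP[A AsA ->] /mapP[B AsB ->]; apply: (row_free_inj freeb).
  by rewrite /= -[LHS]mulmxA -[RHS]mulmxA !defD // !mulmxA !defD // -!mulmxA commA.
exists (u *m b); split.
- by apply: contra nzu => /eqP ub0; apply/eqP/(row_free_inj freeb); rewrite ub0 mul0mx.
- by rewrite (submx_trans (submxMl _ _)) ?defb.
move=> A AsA; rewrite -mulmxA -defD // mulmxA submxMr //.
by apply: stabu; apply: map_f.
Qed.

Lemma geometric_sum_root1 (F : fieldType) (q : nat) (a : F) :
  a ^+ q = 1 -> \sum_(i < q) a ^+ i = if a == 1 then q%:R else 0.
Proof.
move=> aq1; case: eqP => [->|/eqP ne_a1].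
  under eq_bigr do rewrite expr1n.
  by rewrite sumr_const card_ord.
apply: (mulfI (_ : a - 1 != 0)); first by rewrite subr_eq0.
by rewrite -subrX1 aq1 subrr mulr0.
Qed.

Section HolomorphRankOne.

Variables (F : numClosedFieldType) (gT : finGroupType) (G : {group gT}).
Variables (n : nat) (x : gT) (s : nat -> gT).
Hypothesis Gx : x \in G.
Hypothesis Gs : forall t, odd t -> s t \in G.
Hypothesis x2n : (x ^+ (2 ^ n) = 1)%g.
Hypothesis sx : forall t, odd t -> (s t * x = x ^+ t * s t)%g.
Hypothesis sM : forall t u, odd t -> odd u -> s (t * u) = (s t * s u)%g.
Hypothesis s1 : forall t, odd t -> (t = 1 %[mod 2 ^ n])%N -> s t = 1%g.
Hypothesis genG : forall g, g \in G -> exists i t, odd t /\ g = (x ^+ i * s t)%g.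

Lemma s_expg (t i : nat) : odd t -> (s t * x ^+ i = x ^+ (t * i) * s t)%g.
Proof.
move=> ot; elim: i => [|i IHi]; first by rewrite muln0 !expg0 mulg1 mul1g.
by rewrite expgSr mulgA IHi -mulgA sx // mulgA mulnSr expgD.
Qed.

Variables (d : nat) (rG : mx_representation F G d).
Hypothesis irrG : mx_irreducible rG.

Lemma repr_expgS (i t : nat) : odd t -> rG (x ^+ i * s t)%g = rG (x ^+ i)%g *m rG (s t).
Proof. by move=> ot; rewrite repr_mxM ?groupX ?Gs. Qed.

(** If [t] is 1 modulo [2 ^ k], then [s t] preserves the [zeta]-eigenspace of [x], as
    [zeta ^+ t = zeta]. These elements commute, so they have a common eigenvector there. *)
Lemma holomorph_weight_vector :
  exists (v : 'rV_d) (k : nat) (zeta : F) (mu : nat -> F),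
    [/\ v != 0, (2 ^ k).-primitive_root zeta,
        forall i, v *m rG (x ^+ i)%g = zeta ^+ i *: v
      & forall t, odd t -> (t = 1 %[mod 2 ^ k])%N -> v *m rG (s t) = mu t *: v].
Proof.
have d_gt0 : (0 < d)%N by case/mx_irrP: irrG.
have [|v0 nzv0 /andP[/sub_rVP[zeta v0x] _]] := @common_eigenvector F d [:: rG x] d_gt0.
  by move=> A B /[!inE] /eqP-> /eqP->.
have expX p (E : 'M_(p, d)) : E *m rG x = zeta *: E ->
    forall i, E *m rG (x ^+ i)%g = zeta ^+ i *: E.
  move=> defE; elim=> [|i IHi]; first by rewrite expg0 repr_mx1 mulmx1 scale1r.
  by rewrite expgSr repr_mxM ?groupX // mulmxA IHi -scalemxAl defE scalerA -exprSr.
have zeta_q : zeta ^+ (2 ^ n) = 1.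
  apply/eqP; rewrite -subr_eq0; apply: contraTT nzv0 => nz.
  have /eqP : (zeta ^+ (2 ^ n) - 1) *: v0 = 0.
    by rewrite scalerBl -expX // x2n repr_mx1 mulmx1 scale1r subrr.
  by rewrite scaler_eq0 (negPf nz) /= => /eqP->; rewrite eqxx.
have [m prim_zeta] := prim_order_exists (expn_gt0 2 n) zeta_q.
case/(dvdn_pfactor _ _ (isT : prime 2)) => k _ def_m; rewrite {}def_m in prim_zeta.
pose E := eigenspace (rG x) zeta.
have Ex : E *m rG x = zeta *: E by apply/eigenspaceP.
have nzE : E != 0.
  apply: contra nzv0 => /eqP E0; rewrite -submx0 -E0.
  exact/eigenspaceP.
pose K := [set g | `[< exists t, [/\ odd t, (t = 1 %[mod 2 ^ k])%N & g = s t] >]].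
have [|||v [nzv sVE stabv]] := @common_eigenvector_in F d E [seq rG g | g <- enum K].
- by [].
- move=> A /mapP[g /[1!mem_enum] /[1!inE] /asboolP[t [ot t1 ->]] ->].
  apply/eigenspaceP; rewrite -mulmxA -repr_mxM ?Gs // sx // repr_expgS // mulmxA.
  rewrite expX // -scalemxAl; congr (_ *: _).
  by rewrite -(prim_expr_mod prim_zeta) t1 prim_expr_mod.
- move=> A B /mapP[g /[1!mem_enum] /[1!inE] /asboolP[t [ot t1 ->]] ->].
  move=> /mapP[h /[1!mem_enum] /[1!inE] /asboolP[u [ou u1 ->]] ->].
  by rewrite /comm_mx -!repr_mxM ?Gs // -!sM // mulnC.
have vmu t : exists a, odd t -> (t = 1 %[mod 2 ^ k])%N -> v *m rG (s t) = a *: v.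
  have [ot|] := boolP (odd t); last by exists 0.
  have [t1|/eqP nt1] := eqVneq (t %% 2 ^ k)%N (1 %% 2 ^ k)%N; last first.
    by exists 0 => _ /nt1.
  have /sub_rVP[a va] : stablemx v (rG (s t)).
    apply: stabv; apply: map_f; rewrite mem_enum inE; apply/asboolP.
    by exists t.
  by exists a.
have [mu muP] := choice vmu; exists v, k, zeta, mu; split=> //.
exact/expX/eigenspaceP.
Qed.

(** By irreducibility the translates of [v] span the module, and each is a scalar multiple of some
    [v *m rG (s t)]. *)
Lemma rank1_weight_translates (v : 'rV_d) (z : 'M_d) (zeta : F) :
    v != 0 -> (forall i, v *m rG (x ^+ i)%g = zeta ^+ i *: v) -> v *m z != 0 ->
    (forall t, odd t -> (v *m rG (s t) *m z <= v *m z)%MS) ->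
  \rank z = 1%N.
Proof.
move=> nzv vx nzvz vsz.
have sz : (z <= v *m z)%MS.
  rewrite -[X in (X <= _)%MS]mul1mx; apply/row_subP=> i; rewrite row_mul.
  have : (row i 1%:M <= cyclic_mx rG v)%MS.
    have [_ _ gen] := irrG; apply: submx_trans (submx1 _) _.
    by apply: gen; rewrite ?cyclic_mx_module ?submx1 ?cyclic_mx_eq0.
  case/cyclic_mxP=> A /envelop_mxP[a ->] ->.
  rewrite mulmx_sumr mulmx_suml summx_sub // => g Gg.
  rewrite -scalemxAr -scalemxAl scalemx_sub //.
  have [m [t [ot ->]]] := genG Gg.
  by rewrite repr_expgS // mulmxA vx -!scalemxAl scalemx_sub ?vsz.
apply/eqP; rewrite eqn_leq lt0n mxrank_eq0 (leq_trans (mxrankS sz)) ?rank_leq_row //=.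
by apply: contra nzvz => /eqP->; rewrite mulmx0.
Qed.

Lemma holomorph_rank1 :
  exists H : {set gT}, H \subset G /\ \rank (\sum_(h in H) rG h)%R = 1%N.
Proof.
have [v [k [zeta [mu [nzv prim_zeta vx vs]]]]] := holomorph_weight_vector.
(* For [k = 0] every [s t] acts on [v] by a scalar, so the module is a line and the trivial subgroup
   suffices. *)
case: (posnP k) => [k0|k_gt0].
  exists [set 1%g]; split; first by rewrite sub1set.
  rewrite big_set1 repr_mx1.
  apply: (rank1_weight_translates nzv vx) => [|t ot]; first by rewrite mulmx1.
  by rewrite !mulmx1 vs ?scalemx_sub // k0 !modn1.
have oddK t : (t = 1 %[mod 2 ^ k])%N -> odd t := odd_eq1_mod_2exp k_gt0.
have muE t a :
    odd t -> (t = 1 %[mod 2 ^ k])%N -> v *m rG (s t) = a *: v -> mu t = a.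
  move=> ot t1; rewrite vs // => /eqP; rewrite -subr_eq0 -scalerBl scaler_eq0.
  by rewrite (negPf nzv) orbF subr_eq0 => /eqP.
have s11 : s 1 = 1%g by apply: s1.
have [|t u t1 u1||j [w [prim_w mu_w]]] := @mu_conductor F k mu k_gt0 _ _ (k + n).
- by apply: muE => //; rewrite s11 repr_mx1 mulmx1 scale1r.
- have [ot ou] := (oddK _ t1, oddK _ u1).
  apply: muE; rewrite ?oddM ?ot ?ou //; first by rewrite -modnMm t1 u1 modnMm.
  by rewrite sM // repr_mxM ?Gs // mulmxA vs // -scalemxAl vs // scalerA.
- move=> t t1; have tk : (t = 1 %[mod 2 ^ k])%N.
    by apply: eqn_mod_dvd_trans t1; rewrite dvdn_exp2l // leq_addr.
  apply: muE; rewrite ?oddK // s1 ?oddK ?repr_mx1 ?mulmx1 ?scale1r //.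
  by apply: eqn_mod_dvd_trans t1; rewrite dvdn_exp2l // leq_addl.
set M := maxn j k in mu_w; set m := minn j k in prim_w.
have [le_jM le_kM] : (j <= M)%N /\ (k <= M)%N by rewrite leq_maxl leq_maxr.
have M_gt0 : (0 < M)%N by apply: leq_trans le_kM.
(* Since [k - (M - j) = m], the power of [zeta] on the right is a primitive [2 ^ m]-th root of
   unity. With this [c], the factor from [x ^+ (c * r)] cancels [mu (T r)] below. *)
have [c def_w] : exists c, w^-1 = zeta ^+ (2 ^ (M - j) * c).
  have prim_zM : (2 ^ m).-primitive_root (zeta ^+ (2 ^ (M - j))).
    have -> : (2 ^ m = 2 ^ k %/ gcdn (2 ^ (M - j)) (2 ^ k))%N.
      have le_Mjk : (M - j <= k)%N 
        by rewrite leq_subLR /M addnC geq_max leq_addl leq_addr.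
      have /gcdn_idPl-> : (2 ^ (M - j) %| 2 ^ k)%N by rewrite dvdn_exp2l.
      rewrite -expnB //; congr (2 ^ _)%N.
      by apply/eqP; rewrite -(eqn_add2r (M - j)) subnK // addnBA // addn_min_max addKn.
    exact: exp_prim_root.
  have : w^-1 ^+ (2 ^ m) = 1 by rewrite exprVn (prim_expr_order prim_w) invr1.
  by case/(prim_rootP prim_zM) => c ->; exists c; rewrite exprM.
have nzw : w != 0 by rewrite (prim_root_eq0 prim_w) expn_eq0.
have vsx u i : odd u ->
    v *m rG (s u) *m rG (x ^+ i)%g = zeta ^+ (u * i) *: (v *m rG (s u)).
  move=> ou; rewrite -mulmxA -repr_mxM ?groupX ?Gs // s_expg //.
  by rewrite repr_expgS // mulmxA vx -scalemxAl.
have nzz : zeta != 0 by rewrite (prim_root_eq0 prim_zeta) expn_eq0.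
have zeta_q : zeta ^+ (2 ^ n) = 1.
  apply/eqP; rewrite -subr_eq0; apply: contraTT nzv => nz.
  have /eqP : (zeta ^+ (2 ^ n) - 1) *: v = 0.
    by rewrite scalerBl -vx x2n repr_mx1 mulmx1 scale1r subrr.
  by rewrite scaler_eq0 (negPf nz) /= => /eqP->; rewrite eqxx.
(* [H] is the conjugate of [{s_t | t odd, t = 1 mod 2 ^ j}] by the fictitious element
   [x ^ (c / 2 ^ j)], which explains why it is a group. *)
pose T r := (1 + 2 ^ j * r)%N; pose h r := (x ^+ (c * r) * s (T r))%g.
have vh u r : odd u -> odd (T r) ->
    v *m rG (s u) *m rG (h r) = zeta ^+ (u * (c * r)) *: (v *m rG (s (T r * u)%N)).
  move=> ou oT; rewrite repr_expgS // mulmxA vsx // -scalemxAl -mulmxA -repr_mxM ?Gs //.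
  by rewrite -sM // [X in s X]mulnC.
have vh1 r : odd (T r) -> v *m rG (h r) = zeta ^+ (c * r) *: (v *m rG (s (T r))).
  by move=> oT; have := vh 1%N r isT oT; rewrite s11 repr_mx1 mulmx1 mul1n muln1.
have stabE r : (T r = 1 %[mod 2 ^ k])%N -> zeta ^+ (c * r) * mu (T r) = 1.
  move=> T1; have [r' def_r] : exists r', r = (2 ^ (M - j) * r')%N.
    have /dvdnP[r' def_r] : (2 ^ (M - j) %| r)%N.
      rewrite -(dvdn_pmul2l (expn_gt0 2 j : 0 < 2 ^ j)%N) -expnD subnKC //.
      have : (2 ^ k %| 2 ^ j * r)%N.
        by rewrite -[X in (_ %| X)%N](addKn 1) -eqn_mod_dvd //; apply/eqP.
      by rewrite /M; case: leqP => // _ _; rewrite dvdn_mulr.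
    by exists r'; rewrite mulnC.
  have -> : T r = (1 + 2 ^ M * r')%N by rewrite /T def_r mulnA -expnD subnKC.
  rewrite mu_w def_r mulnCA mulnA exprM -def_w.
  by rewrite exprVn mulVf // expf_neq0.
pose H := [set g in G | `[< exists2 r, odd (T r) & g = h r >]].
have groupH : group_set H.
  apply/group_setP; split.
    rewrite inE group1; apply/asboolP; exists 0%N; first by rewrite /T muln0.
    by rewrite /h /T !muln0 s11 mulg1.
  move=> g1 g2 /setIdP[G1 /asboolP[r1 o1 def1]] /setIdP[G2 /asboolP[r2 o2 def2]].
  rewrite inE groupM //; apply/asboolP.
  have eqT : T (r1 + T r1 * r2)%N = (T r1 * T r2)%N by rewrite /T; ring.
  exists (r1 + T r1 * r2)%N; first by rewrite eqT oddM o1 o2.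
  rewrite def1 def2 /h [LHS]mulgA -[X in (X * s (T r2))%g]mulgA s_expg //.
  have eqc : (c * (r1 + T r1 * r2) = c * r1 + T r1 * (c * r2))%N.
    by rewrite (mulnDr c) (mulnCA c).
  by rewrite eqT sM // eqc (expgD _ (c * r1)) !mulgA.
pose z : 'M_d := \sum_(g in H) rG g.
have hz g : g \in H -> rG g *m z = z.
  move=> Hg; rewrite /z mulmx_sumr [RHS](reindex_inj (mulgI g)) /=.
  apply: eq_big => [g'|g' Hg'].
    by have := groupMl g' (Hg : g \in Group groupH) => /= ->.
  by rewrite repr_mxM //; [case/setIdP: Hg | case/setIdP: Hg'].
have Hh r : odd (T r) -> h r \in H.
  by move=> oT; rewrite inE groupM ?groupX ?Gs //; apply/asboolP; exists r.
exists H; split; first by apply/subsetP=> g /setIdP[].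
apply: (rank1_weight_translates (z := z) nzv vx) => [|u ou].
  (* [P] is [2 ^ n] times the projection onto the [zeta]-weight space. It kills [v *m rG g] for [g]
     in [H] unless [g] fixes [v], so [v *m z *m P] is [2 ^ n] times the number of elements of [H]
     fixing [v], times [v]; the identity is one of them. *)
  pose P : 'M_d := \sum_(i < 2 ^ n) (zeta^-1) ^+ i *: rG (x ^+ i)%g.
  have wtP (y : 'rV_d) t : (forall i, y *m rG (x ^+ i)%g = zeta ^+ (t * i) *: y) ->
      y != 0 -> y *m P = (if (t == 1 %[mod 2 ^ k])%N then (2 ^ n)%:R else 0) *: y.
    move=> wty nzy; rewrite mulmx_sumr.
    under eq_bigr => i _ do rewrite -scalemxAr wty scalerA exprM -exprMn.
    rewrite -scaler_suml geometric_sum_root1; last first.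
      by rewrite exprMn exprAC zeta_q expr1n mulr1 exprVn zeta_q invr1.
    rewrite -(inj_eq (mulfI nzz)) mulVKf // mulr1 -[X in _ == X]expr1.
    by rewrite (eq_prim_root_expr prim_zeta).
  have vP : v *m P = (2 ^ n)%:R *: v.
    by rewrite (wtP v 1%N) ?eqxx // => i; rewrite mul1n.
  have Hterm g : g \in H -> v *m rG g *m P = ((v *m rG g == v) * 2 ^ n)%:R *: v.
    case/setIdP=> Gg /asboolP[r oT def_g].
    have [->|ne] := eqVneq; first by rewrite mul1n vP.
    rewrite def_g vh1 // -scalemxAl (wtP _ (T r)); first last.
    - apply: contra nzv => /eqP vs0.
      by rewrite -(repr_mxK rG (Gs oT) v) vs0 mul0mx.
    - by move=> i; rewrite vsx.
    rewrite mul0n scale0r ifN ?scale0r ?scaler0 //.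
    apply: contra ne => /eqP T1; apply/eqP.
    by rewrite def_g vh1 // vs // scalerA stabE // scale1r.
  apply: contra nzv => /eqP vz0.
  have : v *m z *m P = 0 by rewrite vz0 mul0mx.
  rewrite [v *m z]mulmx_sumr mulmx_suml (eq_bigr _ Hterm) -scaler_suml -natr_sum.
  move/eqP; rewrite scaler_eq0 pnatr_eq0 sum_nat_eq0.
  case/orP => [/forall_inP /(_ 1%g) | //].
  have H1 : 1%g \in H by case/group_setP: groupH.
  by rewrite repr_mx1 mulmx1 eqxx mul1n expn_eq0 => /(_ H1).
have [u1|nu1] := eqVneq (u %% 2 ^ m)%N (1 %% 2 ^ m)%N; last first.
  suff -> : v *m rG (s u) *m z = 0 by rewrite sub0mx.
  (* For this [r], [mu (T r) = w], so [h r] acts on the translate by [tau = w ^ (1 - u)], which is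
     not 1. As [z] absorbs [h r], the translate is killed. *)
  pose r := (2 ^ (M - j))%N.
  have def_T : T r = (1 + 2 ^ M * 1)%N by rewrite /T -expnD subnKC // muln1.
  have T1 : (T r = 1 %[mod 2 ^ k])%N.
    by rewrite def_T -(subnK le_kM) addnC expnD mulnAC modnMDl.
  have oT := oddK _ T1.
  pose tau := zeta ^+ (u * (c * r)) * mu (T r).
  have eq_tau : v *m rG (s u) *m z = tau *: (v *m rG (s u) *m z).
    rewrite -{1}(hz _ (Hh r oT)) mulmxA vh // sM // repr_mxM ?Gs // mulmxA vs //.
    by rewrite -!scalemxAl scalerA.
  have ne_tau : tau != 1.
    apply: contra nu1 => /eqP; rewrite /tau def_T mu_w expr1 mulnC exprM [(c * r)%N]mulnC.
    rewrite -def_w exprVn => /(canRL (mulVKf (expf_neq0 u nzw))).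
    by rewrite mulr1 -[LHS]expr1 => /eqP; rewrite (eq_prim_root_expr prim_w) eq_sym.
  apply/eqP; have /eqP : (tau - 1) *: (v *m rG (s u) *m z) = 0.
    by rewrite scalerBl scale1r -eq_tau subrr.
  by rewrite scaler_eq0 subr_eq0 (negPf ne_tau).
(* If [j <= k], then [u = T r] and the translate is a multiple of [v *m rG (h r)]. Otherwise [m = k]
   and [s u] acts on [v] by a scalar. *)
have [le_jk|lt_kj] := leqP j k.
  have /dvdnP[r def_u] : (2 ^ j %| u.-1)%N.
    rewrite -[u.-1]subn1 -eqn_mod_dvd ?odd_gt0 //.
    by move: u1; rewrite /m (minn_idPl le_jk) => ->.
  have {}def_u : u = T r by rewrite /T mulnC -def_u add1n prednK ?odd_gt0.
  have oT : odd (T r) by rewrite -def_u.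
  have := vh1 r oT; rewrite -def_u => eq_vh.
  rewrite -{2}(hz _ (Hh r oT)) mulmxA eq_vh -scalemxAl.
  have nz : zeta ^+ (c * r) != 0.
    by rewrite expf_neq0.
  by rewrite (eqmx_scale _ nz).
rewrite vs // -?scalemxAl ?scalemx_sub //.
by move: u1; rewrite /m (minn_idPr (ltnW lt_kj)).
Qed.

End HolomorphRankOne.

(** * Holomorphs of cyclic groups *)

Lemma Aut_cycle_inj (gT : finGroupType) (a : gT) (f g : {perm gT}) :
  f \in Aut <[a]> -> g \in Aut <[a]> -> f a = g a -> f = g.
Proof.
move=> Af Ag eq_fg; apply: (eq_Aut Af Ag) => _ /cycleP[i ->].
by rewrite -(autmE Af) -(autmE Ag) !morphX ?cycle_id //= !autmE eq_fg.
Qed.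

Lemma Aut_cycle_expg (gT : finGroupType) (a : gT) (t : nat) :
  coprime #[a]%g t -> exists2 f : {perm gT}, f \in Aut <[a]> & f a = (a ^+ t)%g.
Proof.
move=> co_at; have injt : 'injm (cyclem t a).
  apply/subsetP=> y /setIdP[ay]; rewrite !inE -order_dvdn => yt.
  by rewrite -order_eq1 -dvdn1 -(eqnP co_at) dvdn_gcd order_dvdG.
have imt : (cyclem t a @* <[a]> = <[a]>)%g.
  by apply/morphim_fixP=> //; rewrite morphim_cycle ?cycle_id ?cycleX.
by exists (aut injt imt); rewrite ?Aut_aut ?autE ?cycle_id.
Qed.

Lemma schur_index_Hol_cyclic_2exp (R : realType) (n : nat) (gT : finGroupType)
    (C : {group gT}) (d : nat)
    (rG : mx_representation R[i] [set: Hol C]%G d) :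
    (0 < n)%N -> cyclic C -> #|C| = (2 ^ n)%N -> mx_irreducible rG ->
  schur_index rG = 1%N.
Proof.
move=> n_gt0 /cyclicP[a defC] cardC irrG.
have oa : #[a]%g = (2 ^ n)%N by rewrite orderE -defC.
have Ca : a \in C by rewrite defC cycle_id.
have coE t : coprime #[a]%g t = odd t by rewrite oa coprime_pexpl // coprime2n.
have AutC_inj f g : f \in Aut C -> g \in Aut C -> f a = g a -> f = g.
  by rewrite defC; apply: Aut_cycle_inj.
have AutX f i : f \in Aut C -> f (a ^+ i)%g = (f a ^+ i)%g.
  by move=> Af; rewrite -(autmE Af) morphX.
have ex_aut t : exists f : {perm gT}, f \in Aut C /\ (odd t -> f a = (a ^+ t)%g).
  have [ot|_] := boolP (odd t); last by exists 1%g; rewrite group1.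
  have [|f Af fa] := @Aut_cycle_expg _ a t; first by rewrite coE.
  by exists f; rewrite defC.
have [e eP] := choice ex_aut.
have Ae t : e t \in Aut C by case: (eP t).
have ea t : odd t -> e t a = (a ^+ t)%g by case: (eP t).
pose to := [Aut C]%gact.
(* The inverse is taken because the action becomes the right conjugation [x ^ y = y^-1 * x * y],
   whereas [s t * x = x ^+ t * s t] conjugates from the left. *)
pose x : Hol C := sdpair1 to a; pose s t : Hol C := ((sdpair2 to (e t))^-1)%g.
have xX i : sdpair1 to (a ^+ i)%g = (x ^+ i)%g by rewrite morphX.
have [|||||||H [sHG rkH]] := @holomorph_rank1
  R[i] (Hol C) [set: Hol C]%G n x s _ _ _ _ _ _ _ d rG irrG.
- exact: in_setT.
- by move=> t _; apply: in_setT.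
- by rewrite -xX -oa expg_order morph1.
- move=> t ot; have := @sdpair_act _ _ _ _ to a (e t) Ca (Ae t).
  by rewrite [to a _]ea // xX => ->; rewrite conjgE /s -!mulgA mulgV mulg1.
- move=> t u ot ou; rewrite /s -invMg -morphM ?Ae //.
  congr (_^-1)%g; congr (sdpair2 _ _).
  apply: AutC_inj; rewrite ?groupM ?Ae //.
  by rewrite permM !ea ?oddM ?ot ?ou // AutX // ea // expgM.
- move=> t ot t1; rewrite /s (_ : e t = 1%g) ?morph1 ?invg1 //.
  apply: AutC_inj; rewrite ?group1 // perm1 ea //.
  by rewrite -[RHS]expg1; apply/eqP; rewrite eq_expg_mod_order oa t1.
- move=> g _; have : g \in setT by [].
  rewrite -(im_sdpair to) => /mulsgP[_ _ /morphimP[y _ Cy ->] /morphimP[b _ Ab ->] ->].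
  have /cycleP[i ->] : y \in <[a]>%g by rewrite -defC.
  have Ab' : (b^-1)%g \in Aut C by rewrite groupV.
  have /cycleP[t bt] : (b^-1)%g a \in <[a]>%g by rewrite -defC Aut_closed.
  (* An automorphism sends [a] to a generator, so [t] is prime to the order of [a]. *)
  have ot : odd t.
    rewrite -coE -generator_coprime -bt /generator -defC -(autmE Ab').
    by rewrite -morphim_cycle ?Ca //= -defC im_autm.
  exists i, t; split=> //; rewrite -xX; congr (_ * _)%g.
  rewrite /s -morphV ?Ae //; congr (sdpair2 _ _); apply: invg_inj; rewrite invgK.
  by apply: AutC_inj; rewrite ?Ae // bt ea.
exact: schur_index_rank1 irrG sHG rkH.
Qed.

Local Close Scope ring_scope.
Local Close Scope group_scope.

Theorem lemma9p2p1 (R : realType) (n : nat) (gT : finGroupType)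
    (C : {group gT}) (d : nat)
    (rG : mx_representation (R[i])%C [set: Hol C]%G d) :
  3 <= n -> cyclic C -> #|C| = 2 ^ n ->
  mx_irreducible rG -> schur_index rG = 1.
Proof.
by move=> n_ge3; apply: schur_index_Hol_cyclic_2exp; apply: leq_trans n_ge3.
Qed.
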